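(* Let $P$ be a prime, $L: c_1x_1+\dots+c_sx_s=0$ with $c_i\in\mathbb{Z}\setminus\{0\}$, $\sum c_i=0$, and $h_L$ a function as in the context. Let $C\subset\mathbb{Z}/P\mathbb{Z}$ be non-empty. Suppose there exist a subset $S'\subset\mathbb{Z}/P\mathbb{Z}$ with $S'=-S'$, $0\in S'$ and $\operatorname{card}(S')\le t$, a real number $0<\beta\le1$ and constants $c(l)>0$ (depending only on $l$) such that for every integer $l\ge2$ and all $h_1,\dots,h_l\in\mathbb{Z}/P\mathbb{Z}$ with $h_i-h_j\notin S'$ for $i\ne j$, $$d\big((C+h_1)\cap\dots\cap(C+h_l)\big)\le\frac{c(l)}{\beta^l}d(C)^l.$$ Then for every integer $l\ge2$ and every $B\subset\mathbb{Z}/P\mathbb{Z}$ with $\operatorname{card}(B)\ge\frac1{d(C)}$: (i) the set $D:=\{n\in\mathbb{Z}/P\mathbb{Z}: f_C*f_B(n)\ge1/2\}$ has cardinality at least $c\,\beta^{l/(l-1)}P$; and (ii) $\Lambda_L(f_C*f_B)\ge\frac1{2^s}h_L\big(c\,\beta^{l/(l-1)}\big)P^{s-1}$, where $c>0$ is a constant depending only on $t$ and $l$.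
   Context: For $C\subset\mathbb{Z}/P\mathbb{Z}$, $d(C)=\operatorname{card}(C)/P$ and $f_C=\frac1{d(C)}1_C$. $f*g(n)=\frac1P\sum_{y\in\mathbb{Z}/P\mathbb{Z}}f(n-y)g(y)$. $\Lambda_L(f)=\sum_{n_1,\dots,n_s\in\mathbb{Z}/P\mathbb{Z},\ \sum_ic_in_i=0}\prod_if(n_i)$. $h_L:(0,1)\to\mathbb{R}$ is non-negative and such that for every prime $Q$, every $\eta\in(0,1)$ and every $D\subset\mathbb{Z}/Q\mathbb{Z}$ with $\operatorname{card}(D)\ge\eta Q$, the number of $(n_1,\dots,n_s)\in D^s$ with $\sum c_in_i=0$ in $\mathbb{Z}/Q\mathbb{Z}$ is at least $h_L(\eta)Q^{s-1}$. *)

(* Defs.v *)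
From HB Require Import structures.
From mathcomp Require Import all_boot all_order all_algebra.
From mathcomp Require Import reals exp.

Set Implicit Arguments.
Unset Strict Implicit.
Unset Printing Implicit Defensive.

Import Order.TTheory GRing.Theory Num.Theory.
Local Open Scope ring_scope.

(* Z/PZ is 'Z_P, which has P elements only for 1 < P. The definitions below
   are meant for prime P. *)

Definition density (R : realType) (P : nat) (C : {set 'Z_P}) : R :=
  #|C|%:R / P%:R.

Definition normind (R : realType) (P : nat) (C : {set 'Z_P}) (n : 'Z_P) : R :=
  (density R C)^-1 * (n \in C)%:R.

Definition convolution (R : realType) (P : nat) (f g : 'Z_P -> R) (n : 'Z_P) : R :=
  P%:R^-1 * \sum_(y : 'Z_P) f (n - y) * g y.

Definition translate (P : nat) (C : {set 'Z_P}) (h : 'Z_P) : {set 'Z_P} :=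
  [set x + h | x in C].

(* The linear equation L is given by its tuple of coefficients c. *)
Definition solution (s : nat) (c : 'I_s -> int) (P : nat)
    (x : {ffun 'I_s -> 'Z_P}) : bool :=
  \sum_(i < s) (c i)%:~R * x i == 0.

Definition Lambda (R : realType) (s : nat) (c : 'I_s -> int) (P : nat)
    (f : 'Z_P -> R) : R :=
  \sum_(x : {ffun 'I_s -> 'Z_P} | solution c x) \prod_(i < s) f (x i).

(* h is a total function, but only its values on ]0, 1[ are constrained. *)
Definition solution_count_bound (R : realType) (s : nat) (c : 'I_s -> int)
    (h : R -> R) : Prop :=
  (forall eta : R, 0 < eta < 1 -> 0 <= h eta) /\
  (forall (Q : nat) (eta : R) (D : {set 'Z_Q}),
     prime Q -> 0 < eta < 1 -> eta * Q%:R <= #|D|%:R ->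
     h eta * Q%:R ^+ s.-1 <=
       #|[set x : {ffun 'I_s -> 'Z_Q} |
            [forall i, x i \in D] && solution c x]|%:R).

(* Main.v *)
(* Write [N n] for the number of [b] in [B] with [n - b] in [C], so that
   [f_C * f_B = N / X] with [X = d(C) card(B) >= 1]. Choosing elements greedily,
   a set of [N] points contains at least [N (N - t) ... (N - (l - 1) t)]
   [l]-tuples with differences outside [S'], so [N^l] is at most
   [(l t)^(l-1) N] plus [l^l] times the number of such tuples. Summed over [n],
   the tuples are controlled by the hypothesis on intersections of translates
   of [C], which bounds the [l]-th moment of [f_C * f_B] by [K P / beta^l].
   As its mean is [1], it must be at least [1/2] on a large set, and restricting
   [Lambda_L] to that set gives (ii). *)
Require Import Defs.
From HB Require Import structures.
From mathcomp Require Import all_boot all_order all_algebra.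
From mathcomp Require Import reals exp.
From mathcomp Require Import ring lra zify.

Set Implicit Arguments.
Unset Strict Implicit.
Unset Printing Implicit Defensive.

Import Order.TTheory GRing.Theory Num.Theory.
Local Open Scope ring_scope.

(** * Separated tuples in a finite set *)

Lemma sum_mem (T : finType) (A : {set T}) : (\sum_x (x \in A) = #|A|)%N.
Proof.
by rewrite -sum1_card [RHS]big_mkcond; apply: eq_bigr => x _; case: ifP.
Qed.

(** Ordered tuples, so that one can be extended by a last entry; [e x y] will stand for
    [x - y \in S']. *)
Definition separated (T : finType) (e : rel T) (A : {set T}) (k : nat) :
    {set {ffun 'I_k -> T}} :=
  [set f : {ffun 'I_k -> T} |
    [forall i, f i \in A] && [forall i, forall j, (i != j) ==> ~~ e (f i) (f j)]].

Lemma separatedP (T : finType) (e : rel T) (A : {set T}) k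
    (f : {ffun 'I_k -> T}) :
  reflect ((forall i, f i \in A) /\ forall i j, i != j -> ~~ e (f i) (f j))
          (f \in separated e A k).
Proof.
rewrite inE; apply: (iffP andP) => -[fA fe]; split.
- exact/forallP.
- by move=> i j; apply/implyP; move/forallP: fe => /(_ i)/forallP/(_ j).
- exact/forallP.
- by apply/forallP => i; apply/forallP => j; apply/implyP/fe.
Qed.

(** The entries of a separated [j]-tuple exclude at most [j * tau] points as next entry. Truncated
    subtraction covers the case where nothing is left. *)
Lemma card_separated_ge (T : finType) (e : rel T) (A : {set T}) (tau k : nat) :
  symmetric e -> (forall x, #|[set y | e x y]| <= tau)%N ->
  (\prod_(j < k) (#|A| - j * tau) <= #|separated e A k|)%N.
Proof.
move=> e_sym e_tau; elim: k => [|k IHk].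
  rewrite big_ord0 card_gt0; apply/set0Pn.
  have ff (i : 'I_0) : T by case: i.
  exists [ffun i => ff i]; apply/separatedP.
  by split=> [[]|[]].
(* Pairs of a separated [k]-tuple and an admissible last entry; [ext] appends that entry
   injectively, so a lower bound for [#|E|] is enough. *)
pose E := [set p : {ffun 'I_k -> T} * T |
  [&& p.1 \in separated e A k, p.2 \in A & [forall j, ~~ e (p.1 j) p.2]]].
pose ext (p : {ffun 'I_k -> T} * T) : {ffun 'I_k.+1 -> T} :=
  [ffun i => if unlift ord_max i is Some j then p.1 j else p.2].
have ext_inj : injective ext.
  move=> [g b] [g' b'] /ffunP eq_ext; congr pair.
    by apply/ffunP => j; have := eq_ext (lift ord_max j); rewrite !ffunE liftK.
  by have := eq_ext ord_max; rewrite !ffunE unlift_none.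
have sub_ext : ext @: E \subset separated e A k.+1.
  apply/subsetP => _ /imsetP[[g b] + ->].
  rewrite inE /= => /and3P[/separatedP[gA ge] bA /forallP gb].
  apply/separatedP; split=> [i|i j]; rewrite !ffunE /=.
    by case: unliftP.
  case: unliftP => [i' ->|->]; case: unliftP => [j' ->|->] //=.
  - by rewrite (inj_eq lift_inj); apply: ge.
  - by rewrite e_sym.
  - by rewrite eqxx.
apply: leq_trans (subset_leq_card sub_ext); rewrite (card_imset _ ext_inj).
have -> : #|E| = (\sum_(g in separated e A k)
    #|[set b in A | [forall j, ~~ e (g j) b]]|)%N.
  rewrite -sum1_card (eq_bigl (fun p => (p.1 \in separated e A k) &&
      (p.2 \in [set b in A | [forall j, ~~ e (p.1 j) b]]))); last first.
    by move=> p; rewrite !inE.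
  rewrite -(pair_big_dep (mem (separated e A k))
    (fun g b => b \in [set b in A | [forall j, ~~ e (g j) b]]) (fun _ _ => 1%N)).
  by apply: eq_bigr => g _; rewrite sum1_card.
rewrite big_ord_recr /=.
apply: (@leq_trans (\sum_(g in separated e A k) (#|A| - k * tau))%N).
  by rewrite sum_nat_const leq_mul2r IHk orbT.
apply: leq_sum => g _.
have -> : [set b in A | [forall j, ~~ e (g j) b]] =
    A :\: \bigcup_(j < k) [set y | e (g j) y].
  apply/setP => b; rewrite !inE andbC; congr andb.
  apply/forallP/negP => [gb /bigcupP[j _]|gb j].
    by rewrite inE => egb; have := gb j; rewrite egb.
  by apply/negP => egb; apply: gb; apply/bigcupP; exists j; rewrite ?inE.
have : (#|\bigcup_(j < k) [set y | e (g j) y]| <= k * tau)%N.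
  rewrite -[k in leqRHS]card_ord -sum_nat_const.
  apply: (big_ind2 (fun (X : {set T}) n => #|X| <= n)%N) => [|X m Y n Xm Yn|j _].
  - by rewrite cards0.
  - exact: leq_trans (leq_card_setU X Y) (leq_add Xm Yn).
  - exact: e_tau.
have := cardsID (\bigcup_(j < k) [set y | e (g j) y]) A.
have := subset_leq_card (subsetIr A (\bigcup_(j < k) [set y | e (g j) y])).
lia.
Qed.

(** If [#|A| <= k.+1 * tau], the first term suffices. Otherwise every factor [#|A| - j * tau] with
    [j <= k] is at least [#|A| / k.+1], and the second does. *)
Lemma expn_card_le_separated (T : finType) (e : rel T) (A : {set T})
    (tau k : nat) :
  symmetric e -> (forall x, #|[set y | e x y]| <= tau)%N ->
  (#|A| ^ k.+1 <= (k.+1 * tau) ^ k * #|A| + k.+1 ^ k.+1 * #|separated e A k.+1|)%N.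
Proof.
move=> e_sym e_tau; case: (leqP #|A| (k.+1 * tau)) => [A_small|A_large].
  apply: leq_trans (leq_addr _ _); rewrite expnSr leq_mul2r.
  by case: (k) A_small => [|k'] A_small; rewrite ?orbT // leq_exp2r ?A_small ?orbT.
apply: leq_trans (leq_addl _ _).
apply: leq_trans (leq_mul (leqnn _) (card_separated_ge A k.+1 e_sym e_tau)).
have prod_const n : (n ^ k.+1 = \prod_(j < k.+1) n)%N.
  by rewrite prod_nat_const card_ord.
rewrite (prod_const #|A|) (prod_const k.+1) -big_split.
apply: leq_prod => j _ /=.
have := ltn_ord j; rewrite ltnS => jk.
have : (j * (k.+1 * tau) <= k * #|A|)%N by apply: leq_mul => //; apply: ltnW.
nia.
Qed.

(** * From a moment bound to a large level set *)

(* Replaces Hoelder's inequality: [f <= 1/2 + lam 1_D + f^(k+1) / lam^k]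
   pointwise. *)
Lemma level_set_card_ge (R : realType) (T : finType) (f : T -> R) (lam : R) k :
  0 < lam -> (forall x, 0 <= f x) -> \sum_x f x = #|T|%:R ->
  \sum_x f x ^+ k.+1 <= lam ^+ k * (#|T|%:R / 4) ->
  #|T|%:R / (4 * lam) <= #|[set x | 1 / 2 <= f x]|%:R.
Proof.
move=> lam_gt0 f_ge0 f_mean f_moment; set D := [set x | _].
have lamk_gt0 : 0 < lam ^+ k by apply: exprn_gt0.
have f_le x : f x <= 1 / 2 + lam * (x \in D)%:R + f x ^+ k.+1 / lam ^+ k.
  have fk_ge0 : 0 <= f x ^+ k.+1 / lam ^+ k.
    by rewrite divr_ge0 ?exprn_ge0 // ltW.
  rewrite inE; case: (lerP (1 / 2) (f x)) => [f_big|f_small]; last by rewrite /=; lra.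
  case: (lerP (f x) lam) => [f_lam|lam_f]; first by rewrite /=; lra.
  have : f x <= f x ^+ k.+1 / lam ^+ k.
    rewrite ler_pdivlMr // exprS ler_wpM2l //.
    by apply: lerXn2r; rewrite ?nnegrE // ltW.
  by rewrite /=; lra.
have : \sum_x f x <= \sum_x (1 / 2 + lam * (x \in D)%:R + f x ^+ k.+1 / lam ^+ k).
  by apply: ler_sum => x _.
have half_sum : \sum_(x : T) (1 / 2) = #|T|%:R / 2 :> R.
  by rewrite sumr_const div1r -[LHS]mulr_natl.
rewrite f_mean !big_split /= half_sum -mulr_suml -mulr_sumr -natr_sum sum_mem.
(* Of the total [#|T|], the constant takes one half and the moment term at most a quarter, which
   leaves a quarter to [lam * #|D|]. *)
have : (\sum_x f x ^+ k.+1) / lam ^+ k <= #|T|%:R / 4.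
  by rewrite ler_pdivrMr // mulrC.
set M := _ / lam ^+ k => M_le T_le.
by rewrite ler_pdivrMr ?mulr_gt0 //; lra.
Qed.

(** * Fibers of the convolution and their moments *)

Lemma card_Zp_prime (P : nat) : prime P -> #|{: 'Z_P}| = P.
Proof. by move=> P_pr; rewrite card_ord Zp_cast ?prime_gt1. Qed.

Definition fiber (P : nat) (C B : {set 'Z_P}) (n : 'Z_P) : {set 'Z_P} :=
  [set b in B | n - b \in C].

Lemma mem_translate (P : nat) (C : {set 'Z_P}) (h n : 'Z_P) :
  (n \in translate C h) = (n - h \in C).
Proof.
apply/imsetP/idP => [[x xC ->]|nhC]; first by rewrite addrK.
by exists (n - h); rewrite ?subrK.
Qed.

Lemma card_translate (P : nat) (C : {set 'Z_P}) (h : 'Z_P) :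
  #|translate C h| = #|C|.
Proof. exact: card_imset (addIr h). Qed.

Lemma sum_card_fiber (P : nat) (C B : {set 'Z_P}) :
  (\sum_n #|fiber C B n| = #|B| * #|C|)%N.
Proof.
under eq_bigr => n _ do rewrite -sum_mem.
rewrite exchange_big /= -sum_nat_const [RHS]big_mkcond.
apply: eq_bigr => b _; rewrite -(card_translate C b) -sum_mem.
case: ifP => bB; last by rewrite big1 // => n _; rewrite inE bB.
by apply: eq_bigr => n _; rewrite inE bB mem_translate.
Qed.

(** Double counting: a tuple of [B] lies in the fiber over [n] exactly when [n] lies in all the
    translates of [C] by its entries. *)
Lemma sum_card_separated_fiber (P : nat) (C B : {set 'Z_P}) (e : rel 'Z_P) k :
  (\sum_n #|separated e (fiber C B n) k| =
   \sum_(f in separated e B k) #|\bigcap_(i < k) translate C (f i)|)%N.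
Proof.
under eq_bigr => n _ do rewrite -sum_mem.
rewrite exchange_big [RHS]big_mkcond /=; apply: eq_bigr => f _.
have fibE n : (f \in separated e (fiber C B n) k) =
    (f \in separated e B k) && (n \in \bigcap_(i < k) translate C (f i))%SET.
  apply/separatedP/andP => [[fn fe]|[/separatedP[fB fe] /bigcapP fC]].
    have {}fn i : (f i \in B) && (n - f i \in C) by have := fn i; rewrite inE.
    split; first by apply/separatedP; split=> // i; case/andP: (fn i).
    by apply/bigcapP => i _; rewrite mem_translate; case/andP: (fn i).
  by split=> // i; rewrite inE fB -mem_translate fC.
under eq_bigr => n _ do rewrite fibE.
by case: ifP => _ /=; [exact: sum_mem|exact: big1].
Qed.

Lemma convolution_normind (R : realType) (P : nat) (C B : {set 'Z_P}) n :
  prime P ->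
  convolution (normind R C) (normind R B) n =
  #|fiber C B n|%:R / (density R C * #|B|%:R).
Proof.
move=> P_pr; rewrite /convolution /normind.
have P_neq0 : P%:R != 0 :> R by rewrite pnatr_eq0 -lt0n prime_gt0.
have -> : #|fiber C B n|%:R = \sum_y (n - y \in C)%:R * (y \in B)%:R :> R.
  rewrite -sum_mem natr_sum; apply: eq_bigr => y _.
  by rewrite inE andbC -natrM mulnb.
rewrite mulr_suml mulr_sumr; apply: eq_bigr => y _.
(* With the inverses opaque, [field] needs only [P != 0]; empty [C] or [B] are covered by the
   convention that [0] has inverse [0]. *)
move: (density R C) => d; rewrite /density !invfM invrK.
move: (d^-1) (#|B|%:R^-1) => u v.
by field.
Qed.

Lemma sum_card_fiber_expn_le (R : realType) (P k : nat) (C B S' : {set 'Z_P})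
    (M : R) :
  prime P -> [set - x | x in S']%SET = S' -> 0 <= M ->
  (forall h : 'I_k.+1 -> 'Z_P, (forall i j, i != j -> h i - h j \notin S') ->
     density R (\bigcap_(i < k.+1) translate C (h i))%SET <= M) ->
  \sum_n #|fiber C B n|%:R ^+ k.+1 <=
    (k.+1%:R * #|S'|%:R) ^+ k * (#|B|%:R * #|C|%:R)
    + k.+1%:R ^+ k.+1 * (#|B|%:R ^+ k.+1 * (M * P%:R)).
Proof.
(* The symmetry of [S'] is that of [e], and each neighbourhood [x - S'] has the size of [S']. *)
move=> P_pr S'N M_ge0 C_inter; pose e := [rel x y : 'Z_P | x - y \in S'].
have S'V x : (- x \in S') = (x \in S').
  by rewrite -{1}S'N (mem_imset _ _ oppr_inj).
have e_sym : symmetric e by move=> x y; rewrite /= -S'V opprB.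
have e_card x : (#|[set y | e x y]| <= #|S'|)%N.
  rewrite -(card_imset (mem S') (can_inj (subKr x))).
  apply/subset_leq_card/subsetP => y; rewrite inE /= => xyS.
  by apply/imsetP; exists (x - y); rewrite ?subKr.
have P_gt0 : 0 < P%:R :> R by rewrite ltr0n prime_gt0.
have le_nat : \sum_n #|fiber C B n|%:R ^+ k.+1 <=
    (k.+1%:R * #|S'|%:R) ^+ k * (#|B|%:R * #|C|%:R) + k.+1%:R ^+ k.+1 *
    (\sum_(f in separated e B k.+1)
       #|\bigcap_(i < k.+1) translate C (f i)|%:R) :> R.
  under eq_bigr => n _ do rewrite -natrX.
  rewrite -!natr_sum -!(natrM, natrX) -natrD ler_nat -sum_card_fiber.
  rewrite -sum_card_separated_fiber !big_distrr -big_split.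
  by apply: leq_sum => n _; apply: expn_card_le_separated.
apply: (le_trans le_nat); rewrite lerD2l.
apply: ler_wpM2l; first by rewrite exprn_ge0.
apply: (@le_trans _ _ (\sum_(f in separated e B k.+1) (M * P%:R))).
  apply: ler_sum => f /separatedP[_ fe].
  by rewrite -ler_pdivrMr //; apply: C_inter.
(* Separation has served its purpose; the tuples are now bounded by all [#|B| ^ k.+1] tuples of
   [B]. *)
rewrite sumr_const -[leLHS]mulr_natl.
apply: ler_wpM2r; first by rewrite mulr_ge0.
rewrite -natrX ler_nat -[in leqRHS](card_ord k.+1) -card_ffun_on.
apply/subset_leq_card/subsetP => f /separatedP[fB _].
exact/ffun_onP.
Qed.

(** * Lower bound for [Lambda] and choice of the constants *)

(** As [F] is non-negative, only solutions inside the level set are kept; each contributes at least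
    [1 / 2 ^+ s]. *)
Lemma Lambda_ge (R : realType) (P s : nat) (a : 'I_s -> int) (hL : R -> R)
    (F : 'Z_P -> R) (eta : R) :
  prime P -> solution_count_bound a hL -> 0 < eta < 1 -> (forall n, 0 <= F n) ->
  eta * P%:R <= #|[set n : 'Z_P | 1 / 2 <= F n]%SET|%:R ->
  1 / 2 ^+ s * hL eta * P%:R ^+ s.-1 <= Lambda a F.
Proof.
move=> P_pr [_ hLP] eta01 F_ge0 /(hLP _ _ _ P_pr eta01) {hLP}.
set X := [set x | _] => hLX.
rewrite -mulrA; apply: (@le_trans _ _ (\sum_(x in X) (1 / 2 ^+ s))).
  rewrite sumr_const -[leRHS]mulr_natr.
  by apply: ler_wpM2l => //; rewrite divr_ge0 ?exprn_ge0.
have prod_ge0 (x : {ffun 'I_s -> 'Z_P}) : 0 <= \prod_i F (x i).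
  by apply: prodr_ge0.
rewrite /Lambda [leRHS]big_mkcond [leLHS]big_mkcond /=.
apply: ler_sum => x _; rewrite inE.
case: (boolP (solution a x)) => _; rewrite ?andbF ?andbT //.
case: forallP => [xD|_ //].
rewrite div1r -exprVn -[in leLHS](card_ord s) -prodr_const.
apply: ler_prod => i _; rewrite invr_ge0 ler0n /=.
by have := xD i; rewrite inE div1r.
Qed.

(** The constant is chosen before [P], [a], [C], [S'] and [beta], hence uniform in them. Requiring
    [c < 1] keeps [eta] where [hL] is constrained. *)
Theorem theorem2 (R : realType) (cl : nat -> R)
    (hcl : forall k : nat, (2 <= k)%N -> 0 < cl k)
    (t : R) (l : nat) (hl : (2 <= l)%N) :
  exists2 c : R, 0 < c < 1 &
    forall (P : nat) (s : nat) (a : 'I_s -> int) (hL : R -> R)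
           (C S' : {set 'Z_P}) (beta : R),
      prime P ->
      (forall i, a i != 0) -> \sum_(i < s) a i = 0 ->
      solution_count_bound a hL ->
      C != set0 ->
      [set - x | x in S']%SET = S' -> 0 \in S' -> #|S'|%:R <= t ->
      0 < beta <= 1 ->
      (forall (k : nat) (h : 'I_k -> 'Z_P), (2 <= k)%N ->
         (forall i j, i != j -> h i - h j \notin S') ->
         density R (\bigcap_(i < k) translate C (h i))%SET
           <= cl k / beta ^+ k * density R C ^+ k) ->
      forall B : {set 'Z_P},
        1 / density R C <= #|B|%:R ->
        let F := convolution (normind R C) (normind R B) in
        let eta := c * beta `^ (l%:R / (l%:R - 1)) in
        eta * P%:R <= #|[set n : 'Z_P | 1 / 2 <= F n]%SET|%:R
        /\ 1 / 2 ^+ s * hL eta * P%:R ^+ s.-1 <= Lambda a F.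
Proof.
case: l hl => [//|k] k_gt0.
(* [K] is the constant of the moment bound; [t] has no sign yet, hence the absolute value, and the
   summand [1] gives [1 <= K]. *)
pose K := 1 + (k.+1%:R * `|t|) ^+ k + k.+1%:R ^+ k.+1 * cl k.+1.
have cl_gt0 := hcl _ k_gt0.
have K_ge1 : 1 <= K.
  by rewrite /K -addrA lerDl addr_ge0 ?mulr_ge0 ?exprn_ge0 ?mulr_ge0 // ltW.
have K_gt0 : 0 < K by apply: lt_le_trans K_ge1.
(* The level [lam = 4 * K / p] below turns [P / (4 * lam)] into [p * P / (16 * K)]. *)
exists (16 * K)^-1.
  by rewrite invr_gt0 mulr_gt0 //= invf_lt1; nra.
move=> P s a hL C S' beta P_pr _ _ hLP C_neq0 S'N S'0 S't /andP[b_gt0 b_le1].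
move=> C_inter B B_large F eta.
set d := density R C in C_inter B_large.
have P_gt0 : 0 < P%:R :> R by rewrite ltr0n prime_gt0.
have d_gt0 : 0 < d by rewrite divr_gt0 // ltr0n card_gt0.
have dB_ge1 : 1 <= d * #|B|%:R by move: B_large; rewrite ler_pdivrMr // mulrC.
set X := d * #|B|%:R in dB_ge1.
have X_gt0 : 0 < X by apply: lt_le_trans dB_ge1.
have FE n : F n = #|fiber C B n|%:R / X by apply: convolution_normind.
have F_ge0 n : 0 <= F n by rewrite FE divr_ge0 // ltW.
have CE : #|C|%:R = d * P%:R by rewrite /d /density divfK // gt_eqF.
clearbody d.
have F_mean : \sum_n F n = #|{: 'Z_P}|%:R.
  under eq_bigr => n _ do rewrite FE.
  rewrite -mulr_suml -natr_sum sum_card_fiber card_Zp_prime // natrM CE.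
  by rewrite [_ * (d * _)]mulrCA [d * _]mulrA mulrAC divff ?mul1r // gt_eqF.
set p := beta `^ (k.+1%:R / (k.+1%:R - 1)) in eta *.
have p_gt0 : 0 < p by apply: powR_gt0.
have p_le1 : p <= 1.
  have <- : 1 `^ (k.+1%:R / (k.+1%:R - 1)) = 1 :> R by rewrite powR1.
  apply: ge0_ler_powR => //.
  - by rewrite divr_ge0 // subr_ge0 ler1n.
  - by rewrite nnegrE ltW.
  - by rewrite nnegrE.
(* The reason for the exponent [l / (l - 1)]: [lam ^+ k] then has the same power of [beta] in its
   denominator as the moment bound. *)
have pk : p ^+ k = beta ^+ k.+1.
  have k_neq0 : k%:R != 0 :> R by rewrite pnatr_eq0 -lt0n.
  rewrite -powR_mulrn ?(ltW p_gt0) // /p -powRrM -powR_mulrn ?(ltW b_gt0) //.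
  by congr (_ `^ _); rewrite -natr1 addrK divfK.
have eta_bounds : 0 < eta < 1.
  rewrite /eta mulr_gt0 ?invr_gt0 ?mulr_gt0 //=.
  by rewrite mulrC ltr_pdivrMr ?mulr_gt0 //; lra.
suff level : eta * P%:R <= #|[set n : 'Z_P | 1 / 2 <= F n]%SET|%:R.
  by split=> //; apply: Lambda_ge.
(* The natural level is [(4 K)^(1/k) / p]; since [4 K >= 1], the larger
   [4 K / p] serves as well. *)
have lam_gt0 : 0 < 4 * K / p by rewrite divr_gt0 ?mulr_gt0.
rewrite (_ : eta * _ = #|{: 'Z_P}|%:R / (4 * (4 * K / p))); last first.
  by rewrite card_Zp_prime // /eta; field; rewrite !gt_eqF.
apply: (level_set_card_ge (k := k)) => //; rewrite card_Zp_prime //.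
have beta_gt0 : 0 < beta ^+ k.+1 by apply: exprn_gt0.
apply: (@le_trans _ _ (K * P%:R / beta ^+ k.+1)); last first.
  rewrite expr_div_n pk [leRHS]mulrAC ler_wpM2r ?invr_ge0 ?(ltW beta_gt0) //.
  have : 4 * K <= (4 * K) ^+ k by rewrite ler_eXnr //; lra.
  nra.
have Xk_gt0 : 0 < X ^+ k.+1 by apply: exprn_gt0.
under eq_bigr => n _ do rewrite FE expr_div_n.
rewrite -mulr_suml ler_pdivrMr //.
have C_inter' (h : 'I_k.+1 -> 'Z_P) := C_inter k.+1 h k_gt0.
apply: le_trans (sum_card_fiber_expn_le B P_pr S'N _ C_inter') _.
  by apply: mulr_ge0; [apply: divr_ge0|apply: exprn_ge0]; apply: ltW.
have -> : #|B|%:R * #|C|%:R = X * P%:R by rewrite CE /X; ring.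
set bk := beta ^+ k.+1 in beta_gt0 *.
have -> : #|B|%:R ^+ k.+1 * (cl k.+1 / bk * d ^+ k.+1 * P%:R)
    = cl k.+1 * (P%:R / bk * X ^+ k.+1).
  by rewrite /X exprMn; ring.
set Y := P%:R / bk * X ^+ k.+1.
have -> : K * P%:R / bk * X ^+ k.+1 = K * Y by rewrite /Y !mulrA.
(* The term from small fibers is absorbed thanks to [1 <= X], which is the lower bound on [#|B|],
   and [beta <= 1]. *)
have XY : X * P%:R <= Y.
  rewrite /Y mulrC ler_pM ?(ltW X_gt0) ?(ltW P_gt0) //.
    by rewrite ler_pdivlMr // ler_piMr ?(ltW P_gt0) // exprn_ile1 // ltW.
  by rewrite ler_eXnr.
have Y_ge0 : 0 <= Y by apply: le_trans XY; rewrite mulr_ge0 // ltW.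
rewrite /K !mulrDl mul1r -[_ * cl _ * Y]mulrA lerD2r ler_wpDl //.
apply: ler_pM => //; first by rewrite exprn_ge0 ?mulr_ge0.
  by rewrite mulr_ge0 // ltW.
apply: lerXn2r; rewrite ?nnegrE ?mulr_ge0 // ler_wpM2l //.
exact: le_trans S't (ler_norm t).
Qed.
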